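(* Let $E(\mathcal P,F)$ be a quantum vector bundle associated to a locally trivial quantum principal fibre bundle $\mathcal P$ with Hopf algebra $H$ and a left $H$-comodule $F$. Every left gauge transformation on $\mathcal P$ determines a gauge transformation on $E(\mathcal P,F)$.
   Context: Algebras are unital and associative over $\mathbb C$. A covering of an algebra $B$ is a finite family $(J_i)_{i\in I}$ of two-sided ideals with $\bigcap_i J_i=0$; put $B_i=B/J_i$, $B_{ij}=B/(J_i+J_j)$, with quotient maps $\pi_i:B\to B_i$, $\pi^i_j:B_i\to B_{ij}$. The covering is complete if $b\mapsto(\pi_i(b))_i$ maps $B$ onto $\{(b_i)\mid \pi^i_j(b_i)=\pi^j_i(b_j)\ \forall i,j\}$. A locally trivial quantum principal fibre bundle (QPFB) consists of an algebra $B$ with complete covering $(J_i)_{i\in I}$, a Hopf algebra $H$, a right $H$-comodule algebra $\mathcal P$ with coaction $\Delta_{\mathcal P}$, an injective homomorphism $\iota:B\to\mathcal P$, and surjective homomorphisms $\chi_i:\mathcal P\to B_i\otimes H$ such that $\chi_i(\iota(b))=\pi_i(b)\otimes 1$, $(\chi_i\otimes id)\circ\Delta_{\mathcal P}=(id\otimes\Delta)\circ\chi_i$, and $(\ker\chi_i)_{i}$ is a complete covering of $\mathcal P$. A left gauge transformation on $B_i\otimes H$ is an isomorphism $\alpha$ of left $(B_i\otimes 1)$-modules of $B_i\otimes H$ with $(\alpha\otimes id)\circ(id\otimes\Delta)=(id\otimes\Delta)\circ\alpha$ and $\alpha(a\otimes1)=a\otimes 1$. A left gauge transformation on $\mathcal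 P$ is an isomorphism $\alpha_l:\mathcal P\to\mathcal P$ of left $\iota(B)$-modules such that for each $i$ there is a left gauge transformation $\alpha_{l_i}$ on $B_i\otimes H$ with $\chi_i\circ\alpha_l=\alpha_{l_i}\circ\chi_i$. A locally trivial quantum vector bundle $((E,B,\kappa),V,(\zeta_i,J_i)_{i\in I})$ is a left $B$-module $E$ (action $\kappa:B\to \mathrm{End}(E)$) with linear surjections $\zeta_i:E\to B_i\otimes V$ satisfying $\zeta_i(\kappa(a)e)=(\pi_i(a)\otimes 1)\zeta_i(e)$, $\bigcap_i\ker\zeta_i=0$, and the family $(\ker\zeta_i)_i$ being complete in the analogous sense. A gauge transformation on $E$ is a linear automorphism $\eta:E\to E$ with $\kappa(a)\circ\eta=\eta\circ\kappa(a)$ for all $a\in B$ and $\eta(\ker\zeta_i)=\ker\zeta_i$ for all $i$. The associated bundle is $E(\mathcal P,F)=\{e\in\mathcal P\otimes F\mid(\Delta_{\mathcal P}\otimes id)(e)=(id\otimes\Delta_F)(e)\}$, where $\Delta_F:F\to H\otimes F$ is the left coaction, with $\kappa(a)(f\otimes v)=\iota(a)f\otimes v$, $V=F$, and $\zeta_i$ the restriction of $(id\otimes\varepsilon\otimes id)\circ(\chi_i\otimes id)$ to $E(\mathcal P,F)$. *)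

(* Defs.v *)
From HB Require Import structures.
From mathcomp Require Import all_boot all_order all_algebra.
From mathcomp Require Import boolp classical_sets.

Set Implicit Arguments.
Unset Strict Implicit.
Unset Printing Implicit Defensive.

Import GRing.Theory.
Local Open Scope classical_set_scope.
Local Open Scope quotient_scope.
Local Open Scope ring_scope.

(* [algType] is built on [nzRingType] and so excludes the zero algebra,    *)
(* whereas nothing forbids B/J = 0 for a member J of a covering of B.       *)
HB.mixin Record isUnitalAlgebra (K : fieldType) A of GRing.Lmodule K A := {
  aone : A;
  amul : A -> A -> A;
  amulA : associative amul;
  amul1l : left_id aone amul;
  amul1r : right_id aone amul;
  amul_linearl : forall y : A, linear (amul^~ y);
  amul_linearr : forall x : A, linear (amul x)
}.

#[short(type="ualgType")]
HB.structure Definition UnitalAlgebra (K : fieldType) :=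
  {A of GRing.Lmodule K A & isUnitalAlgebra K A}.

Arguments aone {K s}.
Notation "x ⋅ y" := (amul x y) (at level 40, left associativity) : ring_scope.

Record submodule (K : fieldType) (V : lmodType K) := Submodule {
  submodule_pred :> V -> Prop;
  submodule0 : submodule_pred 0;
  submoduleP : forall a u v,
    submodule_pred u -> submodule_pred v -> submodule_pred (a *: u + v)
}.

Section SubmoduleTheory.
Variables (K : fieldType) (V : lmodType K).
Implicit Types W : submodule V.

Lemma submoduleD W u v : W u -> W v -> W (u + v).
Proof. by move=> Wu Wv; rewrite -[u]scale1r; apply: submoduleP. Qed.

Lemma submoduleZ W a u : W u -> W (a *: u).
Proof. by move=> Wu; rewrite -[_ *: _]addr0; apply/submoduleP/submodule0. Qed.

Lemma submoduleN W u : W u -> W (- u).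
Proof. by rewrite -scaleN1r; apply: submoduleZ. Qed.

Lemma submoduleB W u v : W u -> W v -> W (u - v).
Proof. by move=> Wu /submoduleN; apply: submoduleD. Qed.

Definition addm_set W1 W2 : V -> Prop := [set u + v | u in W1 & v in W2].

Lemma addm_set0 W1 W2 : addm_set W1 W2 0.
Proof.
by exists 0; [exact: submodule0|exists 0; [exact: submodule0|rewrite addr0]].
Qed.

Lemma addm_setP W1 W2 a u v :
  addm_set W1 W2 u -> addm_set W1 W2 v -> addm_set W1 W2 (a *: u + v).
Proof.
move=> [u1 W1u1 [u2 W2u2 <-]] [v1 W1v1 [v2 W2v2 <-]].
exists (a *: u1 + v1); first exact: submoduleP.
by exists (a *: u2 + v2); [exact: submoduleP|rewrite scalerDr addrACA].
Qed.

Definition addm W1 W2 := Submodule (addm_set0 W1 W2) (@addm_setP W1 W2).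

Lemma addm_subl W1 W2 : forall u, W1 u -> addm W1 W2 u.
Proof.
by move=> u W1u; exists u => //; exists 0; [exact: submodule0|rewrite addr0].
Qed.

Lemma addm_subr W1 W2 : forall u, W2 u -> addm W1 W2 u.
Proof.
by move=> u W2u; exists 0; [exact: submodule0|exists u; rewrite ?add0r].
Qed.

Variables (U : lmodType K) (f : {linear V -> U}).

Lemma kerm0 : (fun v => f v = 0) 0.
Proof. exact: linear0. Qed.

Lemma kermP a u v : f u = 0 -> f v = 0 -> f (a *: u + v) = 0.
Proof. by move=> fu fv; rewrite linearP fu fv scaler0 addr0. Qed.

Definition kerm := @Submodule K V (fun v => f v = 0) kerm0 kermP.

End SubmoduleTheory.

Section Quotient.
Variables (K : fieldType) (V : lmodType K) (W : submodule V).

Definition quot_rel (u v : V) : bool := `[< W (u - v) >].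

Lemma quot_rel_refl : reflexive quot_rel.
Proof. by move=> u; apply/asboolP; rewrite subrr; apply: submodule0. Qed.

Lemma quot_rel_sym : symmetric quot_rel.
Proof.
by move=> u v; apply: asbool_equiv_eq; split=> /submoduleN; rewrite opprB.
Qed.

Lemma quot_rel_trans : transitive quot_rel.
Proof.
move=> v u w /asboolP uv /asboolP vw; apply/asboolP.
by rewrite -(subrKA v); apply: submoduleD.
Qed.

Canonical quot_equiv :=
  EquivRel quot_rel quot_rel_refl quot_rel_sym quot_rel_trans.

Definition lquot := {eq_quot quot_equiv}.
HB.instance Definition _ := EqQuotient.on lquot.
HB.instance Definition _ := Choice.on lquot.

Lemma lquot_piE (u v : V) : W (u - v) <-> \pi_lquot u = \pi_lquot v.
Proof.
by split=> [/asboolP h|/eqmodP/asboolP//]; apply/eqmodP.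
Qed.

Lemma lquot_repr (u : V) : W (repr (\pi_lquot u) - u).
Proof. by apply/lquot_piE; rewrite reprK. Qed.

Lemma lquotP (x : lquot) : exists v, x = \pi_lquot v.
Proof. by exists (repr x); rewrite reprK. Qed.

Definition lquot_add (x y : lquot) : lquot := \pi_lquot (repr x + repr y).
Definition lquot_opp (x : lquot) : lquot := \pi_lquot (- repr x).
Definition lquot_scale (a : K) (x : lquot) : lquot := \pi_lquot (a *: repr x).

Lemma lquot_addE u v : lquot_add (\pi_lquot u) (\pi_lquot v) = \pi_lquot (u + v).
Proof.
apply/lquot_piE; rewrite opprD addrACA.
by apply: submoduleD; apply: lquot_repr.
Qed.

Lemma lquot_oppE u : lquot_opp (\pi_lquot u) = \pi_lquot (- u).
Proof. by apply/lquot_piE; rewrite -opprD; apply/submoduleN/lquot_repr. Qed.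

Lemma lquot_scaleE a u : lquot_scale a (\pi_lquot u) = \pi_lquot (a *: u).
Proof. by apply/lquot_piE; rewrite -scalerBr; apply/submoduleZ/lquot_repr. Qed.

Lemma lquot_addA : associative lquot_add.
Proof. move=> x y z; have [[u ->] [v ->] [w ->]] := And3 (lquotP x) (lquotP y) (lquotP z).
by rewrite !lquot_addE addrA. Qed.
Lemma lquot_addC : commutative lquot_add.
Proof. by move=> x y; have [[u ->] [v ->]] := conj (lquotP x) (lquotP y); rewrite !lquot_addE addrC. Qed.
Lemma lquot_add0 : left_id (\pi_lquot 0) lquot_add.
Proof. by move=> x; have [u ->] := lquotP x; rewrite lquot_addE add0r. Qed.
Lemma lquot_addN : left_inverse (\pi_lquot 0) lquot_opp lquot_add.
Proof. by move=> x; have [u ->] := lquotP x; rewrite lquot_oppE lquot_addE addNr. Qed.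

HB.instance Definition _ := GRing.isZmodule.Build lquot
  lquot_addA lquot_addC lquot_add0 lquot_addN.

Lemma lquot_scaleA a b x : lquot_scale a (lquot_scale b x) = lquot_scale (a * b) x.
Proof. by have [u ->] := lquotP x; rewrite !lquot_scaleE scalerA. Qed.
Lemma lquot_scale1 : left_id 1 lquot_scale.
Proof. by move=> x; have [u ->] := lquotP x; rewrite !lquot_scaleE scale1r. Qed.
Lemma lquot_scaleDr : right_distributive lquot_scale +%R.
Proof.
move=> a x y; have [[u ->] [v ->]] := conj (lquotP x) (lquotP y).
rewrite -[LHS]/(lquot_scale a (lquot_add _ _)) -[RHS]/(lquot_add _ _).
by rewrite lquot_addE !lquot_scaleE lquot_addE scalerDr.
Qed.
Lemma lquot_scaleDl x : {morph lquot_scale^~ x : a b / a + b}.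
Proof.
move=> a b; have [u ->] := lquotP x; rewrite -[RHS]/(lquot_add _ _).
by rewrite !lquot_scaleE lquot_addE scalerDl.
Qed.

HB.instance Definition _ := GRing.Zmodule_isLmodule.Build K lquot
  lquot_scaleA lquot_scale1 lquot_scaleDr lquot_scaleDl.

Definition qproj (v : V) : lquot := \pi v.

Lemma qproj_linear : linear qproj.
Proof.
move=> a u v; rewrite -[RHS]/(lquot_add (lquot_scale a _) _).
by rewrite lquot_scaleE lquot_addE.
Qed.
HB.instance Definition _ :=
  GRing.isLinear.Build K V lquot *:%R qproj qproj_linear.

Lemma qproj_eq0 v : qproj v = 0 <-> W v.
Proof. by rewrite -[in W v](subr0 v); split=> /lquot_piE. Qed.

Lemma qproj_surj (x : lquot) : exists v, qproj v = x.
Proof. by exists (repr x); rewrite /qproj reprK. Qed.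

End Quotient.

Section QuotientLift.
Variables (K : fieldType) (V U : lmodType K) (W : submodule V).
Variables (f : {linear V -> U}) (Wf : forall v, W v -> f v = 0).

Definition qlift of (forall v, W v -> f v = 0) := fun x : lquot W => f (repr x).

Lemma qliftE v : qlift Wf (qproj W v) = f v.
Proof.
by apply/eqP; rewrite -subr_eq0 -linearB; apply/eqP/Wf/lquot_repr.
Qed.

Lemma qlift_linear : linear (qlift Wf).
Proof.
move=> a x y; have [[u <-] [v <-]] := conj (qproj_surj x) (qproj_surj y).
by rewrite -linearP !qliftE linearP.
Qed.
HB.instance Definition _ :=
  GRing.isLinear.Build K (lquot W) U *:%R (qlift Wf) qlift_linear.

End QuotientLift.

Section Tensor.
Variables (K : fieldType) (U V : lmodType K).

Definition is_bilinear (W : lmodType K) (f : U -> V -> W) : Prop :=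
  (forall v, linear (f^~ v)) /\ (forall u, linear (f u)).

Definition tens_sum (W : lmodType K) (f : U -> V -> W) (s : seq (U * V)) : W :=
  \sum_(x <- s) f x.1 x.2.

(* A list [:: (u_1, v_1); ...; (u_n, v_n)] stands for the formal sum of the *)
(* u_k (x) v_k; two formal sums are identified when no bilinear map tells   *)
(* them apart, so that the universal property holds by construction.        *)
Definition tens_rel (s t : seq (U * V)) : bool :=
  `[< forall (W : lmodType K) (f : U -> V -> W),
        is_bilinear f -> tens_sum f s = tens_sum f t >].

Lemma tens_rel_refl : reflexive tens_rel.
Proof. by move=> s; apply/asboolP. Qed.

Lemma tens_rel_sym : symmetric tens_rel.
Proof. by move=> s t; apply: asbool_equiv_eq; split=> h W f /h. Qed.

Lemma tens_rel_trans : transitive tens_rel.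
Proof.
move=> t s r /asboolP st /asboolP tr; apply/asboolP => W f bf.
by rewrite st ?tr.
Qed.

Canonical tens_equiv :=
  EquivRel tens_rel tens_rel_refl tens_rel_sym tens_rel_trans.

Definition tensor := {eq_quot tens_equiv}.
HB.instance Definition _ := EqQuotient.on tensor.
HB.instance Definition _ := Choice.on tensor.

Lemma tens_piP (s t : seq (U * V)) :
  (forall (W : lmodType K) (f : U -> V -> W),
     is_bilinear f -> tens_sum f s = tens_sum f t) <->
  \pi_tensor s = \pi_tensor t.
Proof.
by split=> [/asboolP h|/eqmodP/asboolP//]; apply/eqmodP.
Qed.

Lemma tens_reprP (t : tensor) : exists s, t = \pi_tensor s.
Proof. by exists (repr t); rewrite reprK. Qed.

Lemma tens_sum_repr (W : lmodType K) (f : U -> V -> W) s :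
  is_bilinear f -> tens_sum f (repr (\pi_tensor s)) = tens_sum f s.
Proof. by apply: (iffRL (tens_piP _ _)); rewrite reprK. Qed.

Lemma tens_sum_cat (W : lmodType K) (f : U -> V -> W) s t :
  tens_sum f (s ++ t) = tens_sum f s + tens_sum f t.
Proof. exact: big_cat. Qed.

Definition tens_scales (a : K) (s : seq (U * V)) := [seq (a *: x.1, x.2) | x <- s].

Lemma tens_sum_scales (W : lmodType K) (f : U -> V -> W) a s :
  is_bilinear f -> tens_sum f (tens_scales a s) = a *: tens_sum f s.
Proof.
move=> [fl _]; rewrite /tens_sum big_map scaler_sumr; apply: eq_bigr => x _ /=.
have f0 : f 0 x.2 = 0.
  by have := fl x.2 (-1) 0 0; rewrite scaler0 addr0 scaleN1r addNr.
by have := fl x.2 a x.1 0; rewrite f0 !addr0.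
Qed.

Definition tens_add (x y : tensor) : tensor := \pi_tensor (repr x ++ repr y).
Definition tens_scale a (x : tensor) : tensor := \pi_tensor (tens_scales a (repr x)).

Lemma tens_addE s t : tens_add (\pi_tensor s) (\pi_tensor t) = \pi_tensor (s ++ t).
Proof.
by apply/tens_piP => W f bf; rewrite !tens_sum_cat !tens_sum_repr.
Qed.

Lemma tens_scaleE a s :
  tens_scale a (\pi_tensor s) = \pi_tensor (tens_scales a s).
Proof.
by apply/tens_piP => W f bf; rewrite !tens_sum_scales ?tens_sum_repr.
Qed.

Lemma tens_addA : associative tens_add.
Proof.
move=> x y z.
have [[s ->] [t ->] [r ->]] := And3 (tens_reprP x) (tens_reprP y) (tens_reprP z).
by rewrite !tens_addE catA.
Qed.

Lemma tens_addC : commutative tens_add.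
Proof.
move=> x y; have [[s ->] [t ->]] := conj (tens_reprP x) (tens_reprP y).
rewrite !tens_addE; apply/tens_piP => W f bf.
by rewrite !tens_sum_cat addrC.
Qed.

Lemma tens_add0 : left_id (\pi_tensor [::]) tens_add.
Proof. by move=> x; have [s ->] := tens_reprP x; rewrite tens_addE. Qed.

Lemma tens_addN : left_inverse (\pi_tensor [::]) (tens_scale (-1)) tens_add.
Proof.
move=> x; have [s ->] := tens_reprP x; rewrite tens_scaleE tens_addE.
apply/tens_piP => W f bf.
by rewrite tens_sum_cat tens_sum_scales // scaleN1r addNr /tens_sum big_nil.
Qed.

HB.instance Definition _ := GRing.isZmodule.Build tensor
  tens_addA tens_addC tens_add0 tens_addN.

Lemma tens_scaleA a b x : tens_scale a (tens_scale b x) = tens_scale (a * b) x.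
Proof.
have [s ->] := tens_reprP x; rewrite !tens_scaleE.
by apply/tens_piP => W f bf; rewrite !tens_sum_scales // scalerA.
Qed.

Lemma tens_scale1 : left_id 1 tens_scale.
Proof.
move=> x; have [s ->] := tens_reprP x; rewrite !tens_scaleE.
by apply/tens_piP => W f bf; rewrite !tens_sum_scales // scale1r.
Qed.

Lemma tens_scaleDr : right_distributive tens_scale +%R.
Proof.
move=> a x y; have [[s ->] [t ->]] := conj (tens_reprP x) (tens_reprP y).
rewrite -[LHS]/(tens_scale a (tens_add _ _)) -[RHS]/(tens_add _ _).
by rewrite tens_addE !tens_scaleE tens_addE /tens_scales map_cat.
Qed.

Lemma tens_scaleDl x : {morph tens_scale^~ x : a b / a + b}.
Proof.
move=> a b; have [s ->] := tens_reprP x; rewrite -[RHS]/(tens_add _ _).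
rewrite !tens_scaleE tens_addE; apply/tens_piP => W f bf.
by rewrite tens_sum_cat !tens_sum_scales // scalerDl.
Qed.

HB.instance Definition _ := GRing.Zmodule_isLmodule.Build K tensor
  tens_scaleA tens_scale1 tens_scaleDr tens_scaleDl.

Definition tpure (u : U) (v : V) : tensor := \pi_tensor [:: (u, v)].

Lemma tpure_bilinear : is_bilinear tpure.
Proof.
split=> [v|u] a x y;
  rewrite -[RHS]/(tens_add (tens_scale a _) _) tens_scaleE tens_addE;
  apply/tens_piP => W f bf;
  rewrite tens_sum_cat tens_sum_scales // /tens_sum !big_seq1 /=; apply bf.
Qed.

Lemma tensor_ind (P : tensor -> Prop) :
  P 0 -> (forall u v, P (tpure u v)) ->
  (forall x y, P x -> P y -> P (x + y)) -> forall t, P t.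
Proof.
move=> P0 Pp PD t; have [s ->] := tens_reprP t; elim: s => // -[u v] s IHs.
rewrite -cat1s -tens_addE; apply: PD => //; exact: Pp.
Qed.

Section Lift.
Variables (W : lmodType K) (f : U -> V -> W) (bf : is_bilinear f).

Definition tlift of is_bilinear f := fun t : tensor => tens_sum f (repr t).

Lemma tlift_linear : linear (tlift bf).
Proof.
move=> a x y; have [[s ->] [t ->]] := conj (tens_reprP x) (tens_reprP y).
rewrite -[a *: _ + _ in LHS]/(tens_add (tens_scale a _) _).
rewrite tens_scaleE tens_addE /tlift !tens_sum_repr //.
by rewrite tens_sum_cat tens_sum_scales.
Qed.
HB.instance Definition _ :=
  GRing.isLinear.Build K tensor W *:%R (tlift bf) tlift_linear.

Lemma tliftE u v : tlift bf (tpure u v) = f u v.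
Proof. by rewrite /tlift tens_sum_repr // /tens_sum big_seq1. Qed.

End Lift.

Lemma tensor_ext (W : lmodType K) (f g : {linear tensor -> W}) :
  (forall u v, f (tpure u v) = g (tpure u v)) -> f =1 g.
Proof.
move=> fg; apply: tensor_ind => [|//|x y fx fy]; first by rewrite !linear0.
by rewrite !linearD fx fy.
Qed.

End Tensor.

Arguments tensor {K} (U V)%_type.
Notation "U ⊗ V" := (tensor U V) (at level 40, left associativity).
Notation "u ⊗ₑ v" := (tpure u v) (at level 40, left associativity) : ring_scope.

Section TensorMaps.
Variable K : fieldType.
Implicit Types U V W : lmodType K.

Lemma tmap_bilinear U U' V V' (f : {linear U -> U'}) (g : {linear V -> V'}) :
  is_bilinear (fun u v => f u ⊗ₑ g v).
Proof.
split=> [v|u] a x y; rewrite linearP; first by rewrite (tpure_bilinear _ _).1.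
by rewrite (tpure_bilinear _ _).2.
Qed.

Definition tmap U U' V V' (f : {linear U -> U'}) (g : {linear V -> V'}) :
  U ⊗ V -> U' ⊗ V' := tlift (tmap_bilinear f g).
HB.instance Definition _ U U' V V' (f : {linear U -> U'})
  (g : {linear V -> V'}) := GRing.Linear.on (tmap f g).

Lemma tmapE U U' V V' (f : {linear U -> U'}) (g : {linear V -> V'}) u v :
  tmap f g (u ⊗ₑ v) = f u ⊗ₑ g v.
Proof. exact: tliftE. Qed.

Lemma tpurel_linear U V (v : V) : linear (fun u : U => u ⊗ₑ v).
Proof. exact: (tpure_bilinear U V).1. Qed.

Definition tpurel U V (v : V) := fun u : U => u ⊗ₑ v.
HB.instance Definition _ U V (v : V) :=
  GRing.isLinear.Build K U (tensor U V) *:%R (tpurel v) (tpurel_linear v).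

Lemma tpurer_linear U V (u : U) : linear (fun v : V => u ⊗ₑ v).
Proof. exact: (tpure_bilinear U V).2. Qed.

Definition tpurer U V (u : U) := fun v : V => u ⊗ₑ v.
HB.instance Definition _ U V (u : U) :=
  GRing.isLinear.Build K V (tensor U V) *:%R (tpurer u) (tpurer_linear u).

Lemma tpure0l U V (v : V) : (0 : U) ⊗ₑ v = 0.
Proof. exact: (linear0 (tpurel v)). Qed.

Lemma tpure0r U V (u : U) : u ⊗ₑ (0 : V) = 0.
Proof. exact: (linear0 (tpurer u)). Qed.

Lemma tassoc_bilinear U V W :
  is_bilinear (fun (u : U) (x : V ⊗ W) => tmap (tpurer u) idfun x).
Proof.
split=> [x|u]; last exact: linearP.
move=> a u u'; elim/tensor_ind: x => [|v w|x y IHx IHy].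
- by rewrite !linear0 ?scaler0 addr0.
- by rewrite !tmapE /= /tpurer (tpurel_linear v) (tpurel_linear w).
- by rewrite !linearD /= IHx IHy addrACA.
Qed.

Definition tassoc U V W : U ⊗ (V ⊗ W) -> (U ⊗ V) ⊗ W :=
  tlift (@tassoc_bilinear U V W).
HB.instance Definition _ U V W := GRing.Linear.on (@tassoc U V W).

Lemma tassocE U V W (u : U) (v : V) (w : W) :
  tassoc (u ⊗ₑ (v ⊗ₑ w)) = (u ⊗ₑ v) ⊗ₑ w.
Proof. by rewrite /tassoc tliftE tmapE. Qed.

Lemma tcontl_bilinear U V (phi : {scalar U}) :
  is_bilinear (fun (u : U) (v : V) => phi u *: v).
Proof.
split=> [v|u] a x y; first by rewrite linearP scalerDl scalerA.
by rewrite scalerDr !scalerA mulrC.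
Qed.

(* [phi (x) id] under the identification of [K (x) V] with [V]. *)
Definition tcontl U V (phi : {scalar U}) : U ⊗ V -> V :=
  tlift (tcontl_bilinear V phi).
HB.instance Definition _ U V (phi : {scalar U}) :=
  GRing.Linear.on (@tcontl U V phi).

Lemma tcontlE U V (phi : {scalar U}) (u : U) (v : V) :
  tcontl phi (u ⊗ₑ v) = phi u *: v.
Proof. exact: tliftE. Qed.

Lemma tcontr_bilinear U V (phi : {scalar V}) :
  is_bilinear (fun (u : U) (v : V) => phi v *: u).
Proof. by have [h1 h2] := tcontl_bilinear U phi. Qed.

(* [id (x) phi] under the identification of [U (x) K] with [U]. *)
Definition tcontr U V (phi : {scalar V}) : U ⊗ V -> U :=
  tlift (tcontr_bilinear U phi).
HB.instance Definition _ U V (phi : {scalar V}) :=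
  GRing.Linear.on (@tcontr U V phi).

Lemma tcontrE U V (phi : {scalar V}) (u : U) (v : V) :
  tcontr phi (u ⊗ₑ v) = phi v *: u.
Proof. exact: tliftE. Qed.

End TensorMaps.
Arguments tassoc {K U V W}.

Section AlgebraTheory.
Variables (K : fieldType) (A : ualgType K).

Definition lmul (a : A) : A -> A := amul a.
HB.instance Definition _ a :=
  GRing.isLinear.Build K A A *:%R (lmul a) (@amul_linearr K A a).

Lemma amulBl (a b c : A) : (a - b) ⋅ c = a ⋅ c - b ⋅ c.
Proof.
by have := amul_linearl c (-1) b a; rewrite !scaleN1r ![- _ + _]addrC.
Qed.

Lemma amulBr (a b c : A) : a ⋅ (b - c) = a ⋅ b - a ⋅ c.
Proof.
by have := amul_linearr a (-1) c b; rewrite !scaleN1r ![- _ + _]addrC.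
Qed.

Lemma mulm_bilinear : is_bilinear (@amul K A).
Proof. by split; [exact: amul_linearl|exact: amul_linearr]. Qed.

Definition mulm : A ⊗ A -> A := tlift mulm_bilinear.
HB.instance Definition _ := GRing.Linear.on mulm.

End AlgebraTheory.

Definition is_unital_hom (K : fieldType) (A A' : ualgType K) (f : A -> A') :=
  f aone = aone /\ (forall x y, f (x ⋅ y) = f x ⋅ f y).

Record ideal (K : fieldType) (A : ualgType K) := Ideal {
  ideal_submodule :> submodule A;
  ideal_mull : forall a x, ideal_submodule x -> ideal_submodule (a ⋅ x);
  ideal_mulr : forall a x, ideal_submodule x -> ideal_submodule (x ⋅ a)
}.

Section QuotientAlgebra.
Variables (K : fieldType) (A : ualgType K) (J : ideal A).
Local Notation AJ := (lquot J).
Local Notation p := (qproj J).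

Definition qmul (x y : AJ) : AJ := p (repr x ⋅ repr y).

Lemma qmulE x y : qmul (p x) (p y) = p (x ⋅ y).
Proof.
apply/lquot_piE; rewrite -(subrKA (x ⋅ repr (p y))); apply: submoduleD.
  by rewrite -amulBl; apply/ideal_mulr/lquot_repr.
by rewrite -amulBr; apply/ideal_mull/lquot_repr.
Qed.

Lemma qmulA : associative qmul.
Proof.
move=> x y z.
have [[u <-] [v <-] [w <-]] := And3 (qproj_surj x) (qproj_surj y) (qproj_surj z).
by rewrite !qmulE amulA.
Qed.

Lemma qmul1l : left_id (p aone) qmul.
Proof. by move=> x; have [u <-] := qproj_surj x; rewrite qmulE amul1l. Qed.

Lemma qmul1r : right_id (p aone) qmul.
Proof. by move=> x; have [u <-] := qproj_surj x; rewrite qmulE amul1r. Qed.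

Lemma qmul_linearl y : linear (qmul^~ y).
Proof.
move=> a x x'.
have [[u <-] [v <-] [w <-]] := And3 (qproj_surj x) (qproj_surj x') (qproj_surj y).
by rewrite -linearP !qmulE (amul_linearl w) linearP.
Qed.

Lemma qmul_linearr x : linear (qmul x).
Proof.
move=> a y y'.
have [[u <-] [v <-] [w <-]] := And3 (qproj_surj x) (qproj_surj y) (qproj_surj y').
by rewrite -linearP !qmulE (amul_linearr u) linearP.
Qed.

HB.instance Definition _ := isUnitalAlgebra.Build K (lquot J)
  qmulA qmul1l qmul1r qmul_linearl qmul_linearr.

Lemma qproj_hom : is_unital_hom p.
Proof. by split=> // x y; rewrite -qmulE. Qed.

End QuotientAlgebra.

Section TensorAlgebra.
Variables (K : fieldType) (A B : ualgType K).

Lemma tmul_bilinear (y : A ⊗ B) :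
  is_bilinear (fun a b => tmap (lmul a) (lmul b) y).
Proof.
split=> [b|a] c x x'; elim/tensor_ind: y => [|u v|y y' IH IH'].
- by rewrite !linear0 addr0.
- by rewrite !tmapE /= /lmul (amul_linearl u) (tpurel_linear (b ⋅ v)).
- by rewrite !linearD /= IH IH' addrACA.
- by rewrite !linear0 addr0.
- by rewrite !tmapE /= /lmul (amul_linearl v) (tpurer_linear (a ⋅ u)).
- by rewrite !linearD /= IH IH' addrACA.
Qed.

Definition tmul (x y : A ⊗ B) : A ⊗ B := tlift (tmul_bilinear y) x.

Lemma tmulE a b a' b' : tmul (a ⊗ₑ b) (a' ⊗ₑ b') = (a ⋅ a') ⊗ₑ (b ⋅ b').
Proof. by rewrite /tmul tliftE tmapE. Qed.

Lemma tmul_linearl y : linear (tmul^~ y).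
Proof. exact: linearP. Qed.

Lemma tmul_linearr x : linear (tmul x).
Proof.
move=> c y y'; rewrite /tmul; elim/tensor_ind: x => [|a b|x x' IH IH'].
- by rewrite !linear0 ?scaler0 addr0.
- by rewrite !tliftE linearP.
- rewrite [LHS]linearD /= IH IH' [tlift _ (x + x')]linearD.
  by rewrite [tlift (tmul_bilinear y') (x + x')]linearD scalerDr addrACA.
Qed.

Lemma tmulDl x x' y : tmul (x + x') y = tmul x y + tmul x' y.
Proof. exact: linearD. Qed.
Lemma tmul0l y : tmul 0 y = 0.
Proof. exact: linear0. Qed.
Lemma tmulDr x y y' : tmul x (y + y') = tmul x y + tmul x y'.
Proof. by have := tmul_linearr x 1 y y'; rewrite !scale1r. Qed.
Lemma tmul0r x : tmul x 0 = 0.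
Proof. by have := tmul_linearr x (-1) 0 0; rewrite scaler0 addr0 scaleN1r addNr. Qed.

Lemma tmulA : associative tmul.
Proof.
elim/tensor_ind=> [|a b|x x' IH IH'] y z; first by rewrite !tmul0l.
  elim/tensor_ind: y => [|a' b'|y y' IH IH']; first by rewrite !(tmul0l, tmul0r).
    elim/tensor_ind: z => [|a'' b''|z z' IH IH']; first by rewrite !tmul0r.
      by rewrite !tmulE !amulA.
    by rewrite !tmulDr IH IH'.
  by rewrite !(tmulDl, tmulDr) IH IH'.
by rewrite !tmulDl IH IH'.
Qed.

Lemma tmul1l : left_id (aone ⊗ₑ aone) tmul.
Proof.
elim/tensor_ind=> [|a b|x x' IH IH']; first exact: tmul0r.
  by rewrite tmulE !amul1l.
by rewrite tmulDr IH IH'.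
Qed.

Lemma tmul1r : right_id (aone ⊗ₑ aone) tmul.
Proof.
elim/tensor_ind=> [|a b|x x' IH IH']; first exact: tmul0l.
  by rewrite tmulE !amul1r.
by rewrite tmulDl IH IH'.
Qed.

HB.instance Definition _ := isUnitalAlgebra.Build K (tensor A B)
  tmulA tmul1l tmul1r tmul_linearl tmul_linearr.

End TensorAlgebra.

Section Subspace.
Variables (K : fieldType) (V : lmodType K) (W : submodule V).

Definition submodule_mem : {pred V} := fun v => `[< W v >].

Lemma submodule_mem_closed : submod_closed submodule_mem.
Proof.
split=> [|a u v /asboolP Wu /asboolP Wv]; first exact/asboolP/submodule0.
exact/asboolP/submoduleP.
Qed.
HB.instance Definition _ :=
  GRing.isSubmodClosed.Build K V submodule_mem submodule_mem_closed.

Record subspace := Subspace {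
  subspace_val :> V;
  _ : subspace_val \in submodule_mem
}.
HB.instance Definition _ := [isSub for subspace_val].
HB.instance Definition _ := [Choice of subspace by <:].
HB.instance Definition _ := [SubChoice_isSubLmodule of subspace by <:].

Lemma subspaceP (x : subspace) : W (subspace_val x).
Proof. by case: x => v /= /asboolP. Qed.

Lemma subspace_val_linear : linear subspace_val.
Proof. by []. Qed.
HB.instance Definition _ :=
  GRing.isLinear.Build K subspace V *:%R subspace_val subspace_val_linear.

End Subspace.

Section Covering.
Variables (K : fieldType) (V : lmodType K).

Lemma qfactor_subproof (W W' : submodule V) :
  (forall v, W v -> W' v) -> forall v, W v -> qproj W' v = 0.
Proof. by move=> sWW' v /sWW' /qproj_eq0. Qed.

Definition qfactor (W W' : submodule V) (sWW' : forall v, W v -> W' v) :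
  lquot W -> lquot W' := qlift (qfactor_subproof sWW').

Definition complete (I : finType) (W : I -> submodule V) : Prop :=
  forall x : (forall i, lquot (W i)),
    (forall i j, qfactor (@addm_subl _ _ (W i) (W j)) (x i) =
                 qfactor (@addm_subr _ _ (W i) (W j)) (x j)) ->
    exists v, forall i, qproj (W i) v = x i.

Definition complete_covering (I : finType) (W : I -> submodule V) : Prop :=
  \bigcap_i [set v | W i v] = [set 0] /\ complete W.

End Covering.

Record hopfAlgebra (K : fieldType) := HopfAlgebra {
  hopf_alg :> ualgType K;
  comul : {linear hopf_alg -> hopf_alg ⊗ hopf_alg};
  counit : {scalar hopf_alg};
  antipode : {linear hopf_alg -> hopf_alg};
  comul_hom : is_unital_hom comul;
  counit1 : counit aone = 1;
  counitM : forall g h, counit (g ⋅ h) = counit g * counit h;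
  comulA : forall h,
    tmap comul idfun (comul h) = tassoc (tmap idfun comul (comul h));
  comul_counitl : forall h, tcontl counit (comul h) = h;
  comul_counitr : forall h, tcontr counit (comul h) = h;
  antipodel : forall h,
    mulm (tmap antipode idfun (comul h)) = counit h *: aone;
  antipoder : forall h,
    mulm (tmap idfun antipode (comul h)) = counit h *: aone
}.
Arguments comul {K} _.
Arguments counit {K} _.

Record rightComoduleAlgebra (K : fieldType) (H : hopfAlgebra K) :=
    RightComoduleAlgebra {
  rcoalg_alg :> ualgType K;
  rcoact : {linear rcoalg_alg -> rcoalg_alg ⊗ H};
  rcoact_hom : is_unital_hom rcoact;
  rcoactA : forall p,
    tmap rcoact idfun (rcoact p) = tassoc (tmap idfun (comul H) (rcoact p));
  rcoact_counit : forall p, tcontr (counit H) (rcoact p) = p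
}.
Arguments rcoact {K H} _.

Record leftComodule (K : fieldType) (H : hopfAlgebra K) := LeftComodule {
  lcomod_space :> lmodType K;
  lcoact : {linear lcomod_space -> H ⊗ lcomod_space};
  lcoactA : forall v,
    tmap (comul H) idfun (lcoact v) = tassoc (tmap idfun lcoact (lcoact v));
  lcoact_counit : forall v, tcontl (counit H) (lcoact v) = v
}.
Arguments lcoact {K H} _.

Section TrivialBundle.
Variables (K : fieldType) (H : hopfAlgebra K).

(* [id (x) comul] with its target reassociated to [(U (x) H) (x) H]. *)
Definition trivial_coact (U : lmodType K) : U ⊗ H -> (U ⊗ H) ⊗ H :=
  tassoc \o tmap idfun (comul H).
HB.instance Definition _ U := GRing.Linear.on (@trivial_coact U).

Definition left_gauge_trivial (A : ualgType K)
    (alpha : {linear A ⊗ H -> A ⊗ H}) : Prop :=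
  [/\ bijective alpha,
      forall a x, alpha ((a ⊗ₑ aone) ⋅ x) = (a ⊗ₑ aone) ⋅ alpha x,
      forall x, tmap alpha idfun (trivial_coact x) = trivial_coact (alpha x)
    & forall a, alpha (a ⊗ₑ aone) = a ⊗ₑ aone].

End TrivialBundle.

Record qpfb (K : fieldType) := Qpfb {
  qpfb_base : ualgType K;
  qpfb_index : finType;
  qpfb_ideal : qpfb_index -> ideal qpfb_base;
  qpfb_hopf : hopfAlgebra K;
  qpfb_total : rightComoduleAlgebra qpfb_hopf;
  qpfb_iota : {linear qpfb_base -> qpfb_total};
  qpfb_chi : forall i, {linear qpfb_total -> lquot (qpfb_ideal i) ⊗ qpfb_hopf};
  qpfb_covering : complete_covering qpfb_ideal;
  qpfb_iota_hom : is_unital_hom qpfb_iota;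
  qpfb_iota_inj : injective qpfb_iota;
  qpfb_chi_hom : forall i, is_unital_hom (qpfb_chi i);
  qpfb_chi_surj : forall i x, exists p, qpfb_chi i p = x;
  qpfb_chi_iota : forall i b,
    qpfb_chi i (qpfb_iota b) = qproj (qpfb_ideal i) b ⊗ₑ aone;
  qpfb_chi_coact : forall i p,
    tmap (qpfb_chi i) idfun (rcoact qpfb_total p) =
    trivial_coact (qpfb_chi i p);
  qpfb_ker_covering : complete_covering (fun i => kerm (qpfb_chi i))
}.

Definition left_gauge (K : fieldType) (Q : qpfb K)
    (alpha : {linear qpfb_total Q -> qpfb_total Q}) : Prop :=
  [/\ bijective alpha,
      forall b p, alpha (qpfb_iota Q b ⋅ p) = qpfb_iota Q b ⋅ alpha p
    & forall i, exists2 alpha_i :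
        {linear lquot (qpfb_ideal i) ⊗ qpfb_hopf Q ->
                lquot (qpfb_ideal i) ⊗ qpfb_hopf Q},
        left_gauge_trivial alpha_i &
        forall p, qpfb_chi i (alpha p) = alpha_i (qpfb_chi i p)].

Section Functional.
Variables (K : fieldType) (V : lmodType K) (S : submodule V) (w : V).
Hypothesis nSw : ~ S w.

Let good (A : set V) := [/\ forall v, S v -> A v, ~ A w &
  forall a u v, A u -> A v -> A (a *: u + v)].

Lemma functional_hyperplane : exists A : submodule V,
  [/\ forall v, S v -> A v, ~ A w & forall v, exists c, A (v - c *: w)].
Proof.
have [F FP Ftot|A [PA Amax]] := @Zorn_bigcup V [set A | A = set0 \/ good A].
  have [[B FB gB]|nF] := pselect (exists2 B, F B & good B); last first.
    left; apply/seteqP; split=> // v [B FB Bv].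
    by have [B0|gB] := FP _ FB; [rewrite B0 in Bv|case: nF; exists B].
  right; split=> [v Sv|[C FC Cw]|a u v [C FC Cu] [D FD Dv]].
  - by exists B => //; case: gB => + _ _; apply.
  - by have [C0|[_ + _]] := FP _ FC; [rewrite C0 in Cw|apply].
  - have [CD|DC] := Ftot _ _ FC FD.
      have [D0|[_ _ gD]] := FP _ FD; first by rewrite D0 in Dv.
      by exists D => //; apply: gD => //; apply: CD.
    have [C0|[_ _ gC]] := FP _ FC; first by rewrite C0 in Cu.
    by exists C => //; apply: gC => //; apply: DC.
have gA : good A.
  case: PA => // A0; have gS : good [set v | S v].
    by split=> // a u v; apply: submoduleP.
  exfalso; apply: (Amax [set v | S v]); last by right.
  split=> [|h]; first by rewrite A0.
  by have := h 0 (submodule0 S); rewrite A0.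
have [SA nAw AP] := gA.
have A0 : A 0 by apply/SA/submodule0.
exists (@Submodule K V A A0 AP); split=> //= v.
have [Av|nAv] := pselect (A v); first by exists 0; rewrite scale0r subr0.
pose B : set V := [set u | exists c, A (u - c *: v)].
have AN u : A u -> A (- u).
  by move=> Au; rewrite -scaleN1r -[_ *: _]addr0; apply: AP.
have AZ c u : A u -> A (c *: u).
  by move=> Au; rewrite -[_ *: _]addr0; apply: AP.
have [c Awc] : B w.
  apply: contrapT => nBw; apply: (Amax B).
    split=> [u Au|BA]; first by exists 0; rewrite scale0r subr0.
    by apply: nAv; apply: BA; exists 1; rewrite scale1r subrr.
  right; split=> // [u Su|a u u' [c Bu] [c' Bu']].
    by exists 0; rewrite scale0r subr0; apply: SA.
  exists (a * c + c'); have := AP a _ _ Bu Bu'.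
  by rewrite scalerBr scalerDl scalerA opprD addrACA.
have [c0|c0] := eqVneq c 0; first by rewrite c0 scale0r subr0 in Awc.
exists c^-1; have := AN _ (AZ c^-1 _ Awc).
by rewrite scalerBr scalerA mulVf // scale1r opprB.
Qed.

Lemma functional_separation : exists phi : {scalar V},
  phi w = 1 /\ forall v, S v -> phi v = 0.
Proof.
have [A [SA nAw dec]] := functional_hyperplane.
have uniq v c d : A (v - c *: w) -> A (v - d *: w) -> c = d.
  move=> Ac Ad; have := submoduleB Ac Ad.
  rewrite opprB addrC subrKA -scaleNr -scalerDl => Aw.
  apply/eqP; rewrite -subr_eq0; apply: contra_notT nAw => ncd.
  have := submoduleZ (d - c)^-1 Aw; rewrite scalerA mulVf ?scale1r //.
  by rewrite -oppr_eq0 opprB.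
pose phi v : K^o := sval (cid (dec v)).
have phiP v : A (v - phi v *: w) by exact: svalP (cid (dec v)).
have phi_lin : linear phi.
  move=> a u v; apply: uniq (phiP _) _.
  have := submoduleP a (phiP u) (phiP v).
  by rewrite scalerBr scalerA addrACA -opprD -scalerDl.
pose phiL : {scalar V} := HB.pack phi (GRing.isLinear.Build K V K^o *%R phi phi_lin).
exists phiL; split=> [|v Sv].
  by apply: uniq (phiP w) _; rewrite scale1r subrr; apply: submodule0.
by apply: uniq (phiP v) _; rewrite scale0r subr0; apply: SA.
Qed.

End Functional.

Section Flatness.
Variables (K : fieldType) (V W : lmodType K).

Fixpoint spanned (L : seq W) (w : W) : Prop :=
  if L is x :: L' then exists c, spanned L' (w - c *: x) else w = 0.

Lemma spanned0 L : spanned L 0.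
Proof. by elim: L => //= x L IH; exists 0; rewrite scale0r subr0. Qed.

Lemma spannedP L a u v : spanned L u -> spanned L v -> spanned L (a *: u + v).
Proof.
elim: L u v => [|x L IH] u v /=; first by move=> -> ->; rewrite scaler0 addr0.
move=> [c hu] [d hv]; exists (a * c + d); have := IH _ _ hu hv.
by rewrite scalerBr scalerDl scalerA opprD addrACA.
Qed.

Definition span_submodule L := Submodule (spanned0 L) (@spannedP L).

Lemma spanned_mem L x : x \in L -> spanned L x.
Proof.
elim: L => //= y L IH; rewrite inE => /orP[/eqP <-|/IH Lx].
  by exists 1; rewrite scale1r subrr; apply: spanned0.
by exists 0; rewrite scale0r subr0.
Qed.

Lemma tens_pi_cons (p : V) (w : W) s :
  \pi_(tensor V W) ((p, w) :: s) = p ⊗ₑ w + \pi_(tensor V W) s.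
Proof. by rewrite -cat1s -tens_addE. Qed.

Lemma tens_absorb (s : seq (V * W)) (p : V) (w : W) :
  spanned [seq x.2 | x <- s] w ->
  exists2 s', size s' = size s & \pi_(tensor V W) s' = p ⊗ₑ w + \pi_(tensor V W) s.
Proof.
elim: s w => [w /= ->|[q x] s IH w /= [c /IH [s' ss' es']]].
  by exists [::] => //; rewrite tpure0r add0r.
exists ((q + c *: p, x) :: s'); first by rewrite /= ss'.
have e1 : p ⊗ₑ (w - c *: x) = p ⊗ₑ w - c *: (p ⊗ₑ x).
  by rewrite -[LHS]/(tpurer p _) linearB linearZ.
have e2 : (q + c *: p) ⊗ₑ x = q ⊗ₑ x + c *: (p ⊗ₑ x).
  by rewrite -[LHS]/(tpurel x _) linearD linearZ.
rewrite !tens_pi_cons es' e1 e2.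
by rewrite addrA addrACA subrr addr0 [X in X + _ = _]addrC -addrA.
Qed.

Lemma tens_joint_inj (I : Type) (X : I -> lmodType K)
    (f : forall i, {linear V -> X i}) :
  (forall p, (forall i, f i p = 0) -> p = 0) ->
  forall t : tensor V W, (forall i, tmap (f i) idfun t = 0) -> t = 0.
Proof.
move=> finj t; have [s ->] := tens_reprP t.
elim: {s}(size s).+1 {-2}s (ltnSn (size s)) => // n IH [|[p w] s] //=.
rewrite ltnS => ltsn h.
have [/(tens_absorb p)[s' ss' es']|nsw] :=
    pselect (span_submodule [seq x.2 | x <- s] w).
  by rewrite tens_pi_cons -es' IH ?ss' // => i; rewrite es' -tens_pi_cons.
have [phi [phiw phi0]] := functional_separation nsw.
have phis (X' : lmodType K) (g : {linear V -> X'}) (r : seq (V * W)) :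
    {subset r <= s} -> tcontr phi (tmap g idfun (\pi_(tensor V W) r)) = 0.
  elim: r => [|[q x] r IHr] rs; first by rewrite !linear0.
  rewrite tens_pi_cons !linearD /= IHr; last first.
    by move=> y ry; apply: rs; rewrite inE ry orbT.
  rewrite tmapE tcontrE phi0 ?scale0r ?addr0 //.
  by apply: spanned_mem; apply/mapP; exists (q, x); rewrite ?rs ?mem_head.
have p0 : p = 0.
  apply: finj => i; have := congr1 (tcontr phi) (h i).
  rewrite tens_pi_cons !linearD /= (phis _ _ s) // addr0 tmapE tcontrE linear0.
  by rewrite phiw scale1r.
have e : \pi_(tensor V W) ((p, w) :: s) = \pi_(tensor V W) s.
  by rewrite tens_pi_cons p0 tpure0l add0r.
by rewrite e IH // => i; rewrite -e.
Qed.

End Flatness.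


Section SubspaceMap.
Variables (K : fieldType) (V V' : lmodType K).
Variables (W : submodule V) (W' : submodule V').
Variable f : {linear V -> V'}.

Definition to_subspace (v : V') (Wv : W' v) : subspace W' :=
  Subspace (introT (asboolP (W' v)) Wv).

Definition subspace_map (h : forall v, W v -> W' (f v)) :=
  fun x : subspace W => to_subspace (h _ (subspaceP x)).

Variable fW : forall v, W v -> W' (f v).

Lemma subspace_map_linear : linear (subspace_map fW).
Proof. by move=> a x y; apply: val_inj; rewrite /= !linearP. Qed.
HB.instance Definition _ := GRing.isLinear.Build K (subspace W) (subspace W')
  *:%R (subspace_map fW) subspace_map_linear.

End SubspaceMap.

(* The data (E, kappa, V, zeta) of a quantum vector bundle over an algebra B *)
(* with covering J, as far as it enters the notion of gauge transformation:  *)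
(* no surjectivity or completeness is imposed on the [vb_triv i].            *)
Record vbundle (K : fieldType) (B : ualgType K) (I : finType)
    (J : I -> ideal B) := VBundle {
  vb_space : lmodType K;
  vb_act : B -> {linear vb_space -> vb_space};
  vb_fibre : lmodType K;
  vb_triv : forall i, {linear vb_space -> lquot (J i) ⊗ vb_fibre};
  vb_act_linear : forall e, linear (fun b => vb_act b e);
  vb_act1 : forall e, vb_act aone e = e;
  vb_actM : forall a b e, vb_act (a ⋅ b) e = vb_act a (vb_act b e);
  vb_triv_act : forall i a e, vb_triv i (vb_act a e) =
    tmap (lmul (qproj (J i) a)) idfun (vb_triv i e)
}.

Definition gauge_transformation (K : fieldType) (B : ualgType K) (I : finType)
    (J : I -> ideal B) (E : vbundle J)
    (eta : {linear vb_space E -> vb_space E}) : Prop :=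
  [/\ bijective eta,
      forall a e, vb_act E a (eta e) = eta (vb_act E a e)
    & forall i, eta @` [set e | vb_triv E i e = 0] =
                [set e | vb_triv E i e = 0]].

Section AssociatedBundle.
Variables (K : fieldType) (Q : qpfb K) (F : leftComodule (qpfb_hopf Q)).
Local Notation P := (qpfb_total Q).
Local Notation H := (qpfb_hopf Q).
Local Notation iota := (qpfb_iota Q).
Local Notation chi := (qpfb_chi (q := Q)).

Lemma chi_joint_inj (W : lmodType K) (x : P ⊗ W) :
  (forall i, tmap (chi i) idfun x = 0) -> x = 0.
Proof.
apply: tens_joint_inj => p chip.
have [cap _] := qpfb_ker_covering Q.
suff: [set 0] p by [].
by rewrite -cap => i _; apply: chip.
Qed.

Lemma rcoact_iota b : rcoact P (iota b) = iota b ⊗ₑ aone.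
Proof.
apply/eqP; rewrite -subr_eq0; apply/eqP/chi_joint_inj => i.
rewrite linearB /= qpfb_chi_coact tmapE qpfb_chi_iota /trivial_coact /= tmapE.
by rewrite (comul_hom H).1 tassocE subrr.
Qed.

Definition assoc_pred (e : P ⊗ F) : Prop :=
  tmap (rcoact P) idfun e = tassoc (tmap idfun (lcoact F) e).

Lemma assoc_pred0 : assoc_pred 0.
Proof. by rewrite /assoc_pred !linear0. Qed.

Lemma assoc_predP a u v : assoc_pred u -> assoc_pred v -> assoc_pred (a *: u + v).
Proof. by rewrite /assoc_pred => hu hv; rewrite !linearP /= hu hv. Qed.

Definition assoc_submodule := Submodule assoc_pred0 assoc_predP.
Definition assoc_space := subspace assoc_submodule.

Lemma tassoc_lmul (a p : P) (y : H ⊗ F) :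
  tassoc (tpurer (a ⋅ p) y) =
  tmap (lmul (a ⊗ₑ aone)) idfun (tassoc (tpurer p y)).
Proof.
elim/tensor_ind: y => [|h v|y y' IH IH'].
- by rewrite !linear0.
- by rewrite !tassocE tmapE /= /lmul [_ ⋅ (_ ⊗ₑ _)]tmulE amul1l.
- by rewrite !linearD /= IH IH'.
Qed.

Lemma assoc_act_stable a (e : P ⊗ F) :
  assoc_submodule e -> assoc_submodule (tmap (lmul (iota a)) idfun e).
Proof.
rewrite /= /assoc_pred => he.
have -> : tmap (rcoact P) idfun (tmap (lmul (iota a)) idfun e) =
          tmap (lmul (iota a ⊗ₑ aone)) idfun (tmap (rcoact P) idfun e).
  elim/tensor_ind: e {he} => [|p v|x y IH IH']; first by rewrite !linear0.
    by rewrite !tmapE /= /lmul (rcoact_hom P).2 rcoact_iota.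
  by rewrite !linearD /= IH IH'.
rewrite {}he; elim/tensor_ind: e => [|p v|x y IH IH'].
- by rewrite !linear0.
- by rewrite !tmapE /=; symmetry; apply: tassoc_lmul.
- by rewrite !linearD /= IH IH'.
Qed.

Definition assoc_act (a : qpfb_base Q) : {linear assoc_space -> assoc_space} :=
  subspace_map (@assoc_act_stable a).

(* [id (x) counit (x) id] after [chi i (x) id]. *)
Definition assoc_triv i : {linear assoc_space -> lquot (qpfb_ideal i) ⊗ F} :=
  tmap (tcontr (counit H)) idfun \o tmap (chi i) idfun \o
  @subspace_val _ _ assoc_submodule.

Lemma tmap_lmulM (A : ualgType K) (W : lmodType K) (a b : A) (x : A ⊗ W) :
  tmap (lmul (a ⋅ b)) idfun x = tmap (lmul a) idfun (tmap (lmul b) idfun x).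
Proof.
elim/tensor_ind: x => [|p v|x y IH IH']; first by rewrite !linear0.
  by rewrite !tmapE /= /lmul amulA.
by rewrite !linearD /= IH IH'.
Qed.

Lemma tmap_lmul1 (A : ualgType K) (W : lmodType K) (x : A ⊗ W) :
  tmap (lmul aone) idfun x = x.
Proof.
elim/tensor_ind: x => [|p v|x y IH IH']; first by rewrite !linear0.
  by rewrite !tmapE /= /lmul amul1l.
by rewrite !linearD /= IH IH'.
Qed.

Lemma tmap_lmul_linear (A : ualgType K) (W : lmodType K) (x : A ⊗ W) :
  linear (fun a => tmap (lmul a) idfun x).
Proof.
move=> c a b; elim/tensor_ind: x => [|p v|x y IH IH'].
- by rewrite !linear0 addr0.
- by rewrite !tmapE /= /lmul (amul_linearl p) (tpurel_linear v).
- by rewrite !linearD /= IH IH' addrACA.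
Qed.

Lemma assoc_act_linear e : linear (fun a => assoc_act a e).
Proof.
by move=> c a b; apply: val_inj; rewrite /= linearP; apply: tmap_lmul_linear.
Qed.

Lemma assoc_act1 e : assoc_act aone e = e.
Proof.
by apply: val_inj; rewrite /= (qpfb_iota_hom Q).1 tmap_lmul1.
Qed.

Lemma assoc_actM a b e : assoc_act (a ⋅ b) e = assoc_act a (assoc_act b e).
Proof.
by apply: val_inj; rewrite /= (qpfb_iota_hom Q).2 tmap_lmulM.
Qed.

Lemma tcontr_lmul (A : ualgType K) (a : A) (x : A ⊗ H) :
  tcontr (counit H) ((a ⊗ₑ aone) ⋅ x) = a ⋅ tcontr (counit H) x.
Proof.
elim/tensor_ind: x => [|b h|x y IH IH'].
- by rewrite -/(lmul _ _) -/(lmul a _) !linear0.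
- rewrite [_ ⋅ (_ ⊗ₑ _)]tmulE !tcontrE amul1l -!/(lmul a _).
  by rewrite [RHS]linearZ.
- rewrite -!/(lmul (a ⊗ₑ aone) _) -!/(lmul a _) in IH IH' *.
  by rewrite !linearD /= IH IH'.
Qed.

Lemma assoc_triv_act i a e : assoc_triv i (assoc_act a e) =
  tmap (lmul (qproj (qpfb_ideal i) a)) idfun (assoc_triv i e).
Proof.
rewrite /assoc_triv /=; elim/tensor_ind: (subspace_val e) => [|p v|x y IH IH'].
- by rewrite !linear0.
- rewrite !tmapE /= /lmul (qpfb_chi_hom i).2 qpfb_chi_iota.
  by rewrite tcontr_lmul.
- by rewrite !linearD /= IH IH'.
Qed.

Definition assoc_bundle : vbundle (@qpfb_ideal K Q) :=
  VBundle assoc_act_linear assoc_act1 assoc_actM assoc_triv_act.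

End AssociatedBundle.

(* Main.v *)
From HB Require Import structures.
Require Import Defs.
From mathcomp Require Import all_boot all_order all_algebra.
From mathcomp Require Import boolp classical_sets reals complex.

Set Implicit Arguments.
Unset Strict Implicit.
Unset Printing Implicit Defensive.

Import GRing.Theory.
Local Open Scope classical_set_scope.
Local Open Scope ring_scope.

(** A left gauge transformation [alpha] is colinear: composing with the
    jointly injective maps [chi_i (x) id] reduces this to the colinearity of
    the [alpha_i].  Hence [alpha (x) id] preserves E(P,F), and so does its
    inverse.  For the kernels, put [x = (chi_i (x) id) e] with [e] in E(P,F).
    Contracting the middle factor H of the cotensor identity for [x] with the
    counit gives [x = (id (x) Delta_F) (zeta_i e)], so that
    [ker zeta_i = ker (chi_i (x) id)] on E(P,F); the latter is preserved
    because [chi_i o alpha = alpha_i o chi_i]. *)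

Lemma linear_inverse (K : fieldType) (V : lmodType K) (f : {linear V -> V}) :
  bijective f -> exists g : {linear V -> V}, cancel f g /\ cancel g f.
Proof.
case=> g fK gK; have g_lin : linear g.
  by move=> a x y; apply: (can_inj fK); rewrite linearP !gK.
pose gL : {linear V -> V} :=
  HB.pack g (GRing.isLinear.Build K V V *:%R g g_lin).
by exists gL.
Qed.

(** * Functoriality of the tensor product and naturality of the associator *)

Section TensorMapTheory.
Variable K : fieldType.
Implicit Types U V W : lmodType K.

Lemma tmap_comp U U' U'' V V' V'' (f : {linear U' -> U''})
    (f' : {linear U -> U'}) (g : {linear V' -> V''}) (g' : {linear V -> V'}) x :
  tmap f g (tmap f' g' x) = tmap (f \o f') (g \o g') x.
Proof.
elim/tensor_ind: x => [|u v|x y IHx IHy]; first by rewrite !linear0.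
  by rewrite !tmapE.
by rewrite !linearD /= IHx IHy.
Qed.

Lemma eq_tmap U U' V V' (f f' : {linear U -> U'}) (g g' : {linear V -> V'}) :
  f =1 f' -> g =1 g' -> tmap f g =1 tmap f' g'.
Proof.
move=> ff gg; elim/tensor_ind=> [|u v|x y IHx IHy]; first by rewrite !linear0.
  by rewrite !tmapE ff gg.
by rewrite !linearD /= IHx IHy.
Qed.

Lemma tmap_id U V : @tmap K U U V V idfun idfun =1 id.
Proof.
elim/tensor_ind=> [|u v|x y IHx IHy]; [exact: linear0|exact: tmapE|].
by rewrite linearD /= IHx IHy.
Qed.

Lemma tmap_cancel U U' V (f : {linear U -> U'}) (g : {linear U' -> U}) :
  cancel f g -> cancel (tmap f (@idfun V)) (tmap g (@idfun V)).
Proof.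
move=> fK x; rewrite tmap_comp -[RHS]tmap_id.
by apply: eq_tmap => // u; rewrite /= fK.
Qed.

Lemma tassoc_tmap U U' V V' W W' (f : {linear U -> U'}) (g : {linear V -> V'})
    (h : {linear W -> W'}) x :
  tassoc (tmap f (tmap g h) x) = tmap (tmap f g) h (tassoc x).
Proof.
elim/tensor_ind: x => [|u y|x y IHx IHy]; first by rewrite !linear0.
  elim/tensor_ind: y => [|v w|x y IHx IHy]; first by rewrite tpure0r !linear0.
    by rewrite tassocE !tmapE /= !tmapE tassocE.
  by rewrite -[_ ⊗ₑ _]/(tpurer u _) !linearD /= IHx IHy.
by rewrite !linearD /= IHx IHy.
Qed.

Lemma tmap_tcontr_tassoc U V W (phi : {scalar V}) (x : U ⊗ (V ⊗ W)) :
  tmap (tcontr phi) idfun (tassoc x) = tmap idfun (tcontl phi) x.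
Proof.
elim/tensor_ind: x => [|u y|x y IHx IHy]; first by rewrite !linear0.
  elim/tensor_ind: y => [|v w|x y IHx IHy]; first by rewrite tpure0r !linear0.
    rewrite tassocE !tmapE /= tcontrE tcontlE.
    by rewrite -[LHS]/(tpurel w _) -[RHS]/(tpurer u _) !linearZ.
  by rewrite -[_ ⊗ₑ _]/(tpurer u _) !linearD /= IHx IHy.
by rewrite !linearD /= IHx IHy.
Qed.

End TensorMapTheory.

Section TrivialBundleGauge.
Variables (K : fieldType) (H : hopfAlgebra K).

(** The contracted factor is the first leg of the coproduct, so this is the left counit law of
    [H]. *)
Lemma tcontr_trivial_coact (U : lmodType K) (x : U ⊗ H) :
  tmap (tcontr (counit H)) idfun (trivial_coact x) = x.
Proof.
rewrite /trivial_coact /= tmap_tcontr_tassoc tmap_comp -[RHS]tmap_id.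
by apply: eq_tmap => // h; apply: comul_counitl.
Qed.

Lemma left_gauge_trivial_inverse (A : ualgType K)
    (f g : {linear A ⊗ H -> A ⊗ H}) :
  cancel f g -> cancel g f -> left_gauge_trivial f -> left_gauge_trivial g.
Proof.
move=> fK gK [_ fM fcoact f1]; split=> [|a x|x|a].
- by exists f.
- by apply: (can_inj fK); rewrite fM !gK.
(* Colinearity of [f] is used at [g x]; then [tmap g idfun] cancels [tmap f idfun]. *)
- by rewrite -{1}[x]gK -fcoact tmap_cancel.
- by rewrite -{1}[_ ⊗ₑ _]f1 fK.
Qed.

End TrivialBundleGauge.

(** * Gauge transformations of the total space: inverses and colinearity *)

Section LeftGauge.
Variables (K : fieldType) (Q : qpfb K).

(** Inverting the local maps index by index suffices. This serves the reverse inclusion in the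
    condition on kernels. *)
Lemma left_gauge_inverse (f g : {linear qpfb_total Q -> qpfb_total Q}) :
  cancel f g -> cancel g f -> left_gauge f -> left_gauge g.
Proof.
move=> fK gK [_ fM f_loc]; split=> [|b p|i].
- by exists f.
- by apply: (can_inj fK); rewrite fM !gK.
have [f_i gauge_i chi_f] := f_loc i.
have [f_i_bij _ _ _] := gauge_i.
have [g_i [f_iK g_iK]] := linear_inverse f_i_bij.
exists g_i; first exact: left_gauge_trivial_inverse gauge_i.
by move=> p; rewrite -{2}[p]gK chi_f f_iK.
Qed.

Lemma left_gauge_colinear (alpha : {linear qpfb_total Q -> qpfb_total Q}) p :
  left_gauge alpha ->
  tmap alpha idfun (rcoact (qpfb_total Q) p) = rcoact (qpfb_total Q) (alpha p).
Proof.
move=> [_ _ alpha_loc].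
apply/eqP; rewrite -subr_eq0; apply/eqP/chi_joint_inj => i.
have [alpha_i [_ _ coact_i _] chi_alpha] := alpha_loc i.
(* Both terms become images of [rcoact p], under [chi_i o alpha] and [alpha_i o chi_i] tensored with
   the identity of [H]. *)
rewrite linearB /= qpfb_chi_coact chi_alpha -coact_i -qpfb_chi_coact !tmap_comp.
by apply/eqP; rewrite subr_eq0; apply/eqP/eq_tmap => // q; apply: chi_alpha.
Qed.

End LeftGauge.

(** Apply the counit to the first [H] on both sides of the hypothesis: on the left the counit law
    returns [x], on the right the contraction commutes with the coaction of [F]. *)
Lemma cotensor_counit (K : fieldType) (H : hopfAlgebra K) (F : leftComodule H)
    (U : lmodType K) (x : (U ⊗ H) ⊗ F) :
  tmap (@trivial_coact _ _ _) idfun x = tassoc (tmap idfun (lcoact F) x) ->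
  tassoc (tmap idfun (lcoact F) (tmap (tcontr (counit H)) idfun x)) = x.
Proof.
move=> /(congr1 (tmap (tmap (tcontr (counit H)) idfun) idfun)).
rewrite -tassoc_tmap !tmap_comp => hx.
transitivity (tassoc (tmap (tcontr (counit H) \o idfun)
    (tmap idfun idfun \o lcoact F) x)).
  by congr tassoc; apply: eq_tmap => // v; rewrite /= tmap_id.
rewrite -hx -[RHS]tmap_id; apply: eq_tmap => // y.
exact: tcontr_trivial_coact.
Qed.

Section AssociatedGauge.
Variables (K : fieldType) (Q : qpfb K) (F : leftComodule (qpfb_hopf Q)).
Variable alpha : {linear qpfb_total Q -> qpfb_total Q}.
Hypothesis alpha_gauge : left_gauge alpha.

(** Colinearity moves [alpha] past the coaction of P, while [alpha] and the coaction of [F] act on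
    different tensor factors. *)
Lemma assoc_gauge_stable (e : qpfb_total Q ⊗ F) :
  assoc_submodule F e -> assoc_submodule F (tmap alpha idfun e).
Proof.
rewrite /= /assoc_pred => he.
have -> : tmap (rcoact (qpfb_total Q)) idfun (tmap alpha idfun e) =
    tmap (tmap alpha idfun) idfun (tmap (rcoact (qpfb_total Q)) idfun e).
  rewrite !tmap_comp; apply: eq_tmap => // p.
  by rewrite /= left_gauge_colinear.
rewrite he -tassoc_tmap !tmap_comp; congr tassoc.
by apply: eq_tmap => // v; rewrite /= tmap_id.
Qed.

Definition assoc_gauge : {linear assoc_space F -> assoc_space F} :=
  subspace_map assoc_gauge_stable.

Lemma assoc_gauge_act a e :
  assoc_act F a (assoc_gauge e) = assoc_gauge (assoc_act F a e).
Proof.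
have [_ alphaM _] := alpha_gauge.
apply: val_inj; rewrite /= !tmap_comp; apply: eq_tmap => // p.
by rewrite /= /lmul alphaM.
Qed.

End AssociatedGauge.

(** * Kernels of the local trivialisations *)

Section AssociatedKernel.
Variables (K : fieldType) (Q : qpfb K) (F : leftComodule (qpfb_hopf Q)).
Local Notation chi := (qpfb_chi (q := Q)).

(** Colinearity of [chi i] carries the equation defining E(P,F) over to the trivial bundle. *)
Lemma chi_cotensor i (e : assoc_space F) :
  tmap (@trivial_coact _ _ _) idfun (tmap (chi i) idfun (subspace_val e)) =
  tassoc (tmap idfun (lcoact F) (tmap (chi i) idfun (subspace_val e))).
Proof.
have := congr1 (tmap (tmap (chi i) idfun) idfun) (subspaceP e).
rewrite -tassoc_tmap !tmap_comp => he.
transitivity (tmap (tmap (chi i) idfun \o rcoact (qpfb_total Q))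
    (idfun \o idfun) (subspace_val e)).
  by apply: eq_tmap => // p; rewrite /= qpfb_chi_coact.
rewrite he; congr tassoc; apply: eq_tmap => // v.
by rewrite /= tmap_id.
Qed.

Lemma tassoc_assoc_triv i (e : assoc_space F) :
  tassoc (tmap idfun (lcoact F) (assoc_triv F i e)) =
  tmap (chi i) idfun (subspace_val e).
Proof. exact: cotensor_counit (chi_cotensor i e). Qed.

(** Nothing is lost by contracting with the counit: the coaction of [F] restores the factor [H]. *)
Lemma assoc_triv_eq0 i (e : assoc_space F) :
  assoc_triv F i e = 0 <-> tmap (chi i) idfun (subspace_val e) = 0.
Proof.
split=> [triv0|chi0]; first by rewrite -tassoc_assoc_triv triv0 !linear0.
by rewrite /assoc_triv /= chi0 linear0.
Qed.

(** The map [alpha_i] acts before the counit is applied, so both kernel conditions are first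
    restated without the counit. *)
Lemma assoc_gauge_ker (alpha : {linear qpfb_total Q -> qpfb_total Q})
    (alpha_gauge : left_gauge alpha) i (e : assoc_space F) :
  assoc_triv F i e = 0 -> assoc_triv F i (assoc_gauge F alpha_gauge e) = 0.
Proof.
move=> /assoc_triv_eq0 chi0; apply/assoc_triv_eq0.
have [_ _ /(_ i)[alpha_i _ chi_alpha]] := alpha_gauge.
rewrite -[RHS](linear0 (tmap alpha_i idfun)) -chi0 /= !tmap_comp.
by apply: eq_tmap => // p; apply: chi_alpha.
Qed.

Lemma assoc_gauge_cancel (f g : {linear qpfb_total Q -> qpfb_total Q})
    (f_gauge : left_gauge f) (g_gauge : left_gauge g) :
  cancel f g -> cancel (assoc_gauge F f_gauge) (assoc_gauge F g_gauge).
Proof. by move=> fK e; apply: val_inj; rewrite /= tmap_cancel. Qed.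

End AssociatedKernel.

Theorem proposition8 (R : realType) (Q : qpfb R[i])
    (F : leftComodule (qpfb_hopf Q))
    (alpha : {linear qpfb_total Q -> qpfb_total Q}) :
  left_gauge alpha ->
  exists eta : {linear assoc_space F -> assoc_space F},
    gauge_transformation (E := assoc_bundle F) eta /\
    forall e, subspace_val (eta e) = tmap alpha idfun (subspace_val e).
Proof.
move=> alpha_gauge; have [alpha_bij _ _] := alpha_gauge.
have [beta [alphaK betaK]] := linear_inverse alpha_bij.
have beta_gauge := left_gauge_inverse alphaK betaK alpha_gauge.
have etaK := assoc_gauge_cancel (F := F) alpha_gauge beta_gauge alphaK.
have etaVK := assoc_gauge_cancel (F := F) beta_gauge alpha_gauge betaK.
exists (assoc_gauge F alpha_gauge); split=> //; split=> [|a e|i].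
- by exists (assoc_gauge F beta_gauge).
- exact: assoc_gauge_act.
apply/seteqP; split=> [_ [e e0 <-]|e e0]; first exact: assoc_gauge_ker.
(* The preimage under the inverse stays in the kernel because [beta] is itself a left gauge
   transformation. *)
by exists (assoc_gauge F beta_gauge e); [exact: assoc_gauge_ker|exact: etaVK].
Qed.
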